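(* For every positive integer $t$ there is a constant $C_t$ such that for every integer $d\ge 1$ there is a signed spherical $t$-design on $S^{d-1}$ with at most $C_t\,d^{\lfloor t/2\rfloor}$ points, and there is a signed Gaussian $t$-design in $\mathbb{R}^d$ with at most $C_t\,d^{\lfloor t/2\rfloor}$ points.
   Context: Let $\mu$ be the Lebesgue (surface) measure on the unit sphere $S^{d-1}\subset\mathbb{R}^d$ normalized so that $\mu(S^{d-1})=1$, and let $\rho$ be the Gaussian probability measure $d\rho=e^{-\pi|x|^2}\,dx$ on $\mathbb{R}^d$. A signed spherical $t$-design is a finite set $X\subset S^{d-1}$ with a function $w\colon X\to\mathbb{R}$ (possibly taking negative values) such that $\sum_{x\in X}w(x)f(x)=\int_{S^{d-1}}f\,d\mu$ for every polynomial $f$ of total degree at most $t$. A signed Gaussian $t$-design is a finite set $X\subset\mathbb{R}^d$ with a function $w\colon X\to\mathbb{R}$ such that $\sum_{x\in X}w(x)f(x)=\int_{\mathbb{R}^d}f\,d\rho$ for every polynomial $f$ of total degree at most $t$. *)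

(* Defs.v *)
From HB Require Import structures.
From mathcomp Require Import all_boot all_order all_algebra finmap.
(* Imported first and without notations: [mpoly] reuses names and notations of
   MathComp-Analysis. *)
From mathcomp Require Import -(notations) mpoly.
From mathcomp Require Import all_classical all_reals all_analysis measurable_realfun.

Set Implicit Arguments.
Unset Strict Implicit.
Unset Printing Implicit Defensive.

Import Order.TTheory GRing.Theory Num.Theory.
Import numFieldNormedType.Exports.

Local Open Scope classical_set_scope.
Local Open Scope ring_scope.

(* R^d is [d.-tuple R], which carries the product of the Borel
   sigma-algebras of the factors. *)

Section tuple_cons.
Context {R : realType}.

Definition tcons n (p : measurableTypeR R * n.-tuple R) : n.+1.-tuple R :=
  [tuple of p.1 :: p.2].

Lemma measurable_tcons n : measurable_fun setT (@tcons n).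
Proof. exact: measurable_cons. Qed.

Definition tuncons n (x : n.+1.-tuple R) : measurableTypeR R * n.-tuple R :=
  (thead x, [tuple of behead x]).

Lemma tconsK n : cancel (@tcons n) (@tuncons n).
Proof. by case=> a v; congr (_, _); exact/val_inj. Qed.

Lemma measurable_tuncons n : measurable_fun setT (@tuncons n).
Proof.
apply/measurable_fun_pairP; split; last exact: measurable_behead.
exact: measurable_tnth.
Qed.

End tuple_cons.

Section lebesgue_measure_succ.
Local Open Scope ereal_scope.
Context {R : realType} (n : nat).
Variable m : {sigma_finite_measure set (n.-tuple R) -> \bar R}.

Definition leb_succ : set (n.+1.-tuple R) -> \bar R :=
  pushforward (@lebesgue_measure R \x m) (@tcons R n).

Let leb_succ0 : leb_succ set0 = 0.
Proof. by rewrite /leb_succ /pushforward preimage_set0 measure0. Qed.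

Let leb_succ_ge0 A : 0 <= leb_succ A.
Proof. by apply: integral_ge0 => x _; exact: measure_ge0. Qed.

Let leb_succ_sigma_additive : semi_sigma_additive leb_succ.
Proof.
move=> F mF tF mUF; rewrite /leb_succ /pushforward preimage_bigcup.
have mpF k : measurable (@tcons R n @^-1` F k).
  by rewrite -[X in measurable X]setTI; exact: measurable_tcons.
apply: (@measure_semi_sigma_additive _ _ _ (@lebesgue_measure R \x m)) => //.
  apply/trivIsetP => i j _ _ ij; rewrite -preimage_setI.
  by move/trivIsetP : tF => /(_ _ _ I I ij) ->; rewrite preimage_set0.
exact: bigcup_measurable.
Qed.

HB.instance Definition _ := isMeasure.Build _ _ _
  leb_succ leb_succ0 leb_succ_ge0 leb_succ_sigma_additive.

Let leb_succ_sigma_finite : sigma_finite setT leb_succ.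
Proof.
have /sigma_finiteP[F [TF ndF Foo]] := sigma_finiteT (@lebesgue_measure R).
have /sigma_finiteP[G [TG ndG Goo]] := sigma_finiteT m.
exists (fun k => @tuncons R n @^-1` (F k `*` G k)) => [|k].
  apply/seteqP; split => // x _.
  have [i _ Fi] : (\bigcup_i F i) (tuncons x).1 by rewrite -TF.
  have [j _ Gj] : (\bigcup_i G i) (tuncons x).2 by rewrite -TG.
  exists (maxn i j) => //; split.
    by move: Fi; exact/subsetPset/ndF/leq_maxl.
  by move: Gj; exact/subsetPset/ndG/leq_maxr.
have [mF Fk] := Foo k; have [mG Gk] := Goo k; split.
  rewrite -[X in measurable X]setTI; apply: measurable_tuncons => //.
  exact: measurableX.
rewrite /leb_succ /pushforward -comp_preimage.
rewrite (_ : _ \o _ = id); last by apply/funext => p; exact: tconsK.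
by rewrite preimage_id product_measure1E// lte_mul_pinfty// ge0_fin_numE.
Qed.

HB.instance Definition _ := Measure_isSigmaFinite.Build _ _ _ leb_succ
  leb_succ_sigma_finite.

End lebesgue_measure_succ.

(* Lebesgue measure on R^n, as an iterated product measure; on the one-point
   space R^0 it is the unit mass. *)
Fixpoint leb {R : realType} (n : nat) :
    {sigma_finite_measure set (n.-tuple R) -> \bar R} :=
  match n with
  | 0 => \d_([tuple] : 0.-tuple R)
  | n'.+1 => leb_succ (leb n')
  end.

Section euclidean.
Context {R : realType} {d : nat}.
Implicit Types (x : d.-tuple R) (A : set (d.-tuple R)).

Definition enorm x : R := Num.sqrt (\sum_(i < d) tnth x i ^+ 2).

Definition sphere : set (d.-tuple R) := [set x | enorm x = 1].

Definition direction x : d.-tuple R := [tuple tnth x i / enorm x | i < d].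

Lemma measurable_enorm : measurable_fun [set: d.-tuple R] enorm.
Proof.
apply: (@measurableT_comp _ _ _ _ _ _ (@Num.sqrt R)) => //.
  by apply: continuous_measurable_fun; exact: sqrt_continuous.
by apply: measurable_sum => i; apply: measurable_funX; exact: measurable_tnth.
Qed.

Lemma measurable_direction : measurable_fun [set: d.-tuple R] direction.
Proof.
apply/measurable_fun_tnthP => i.
rewrite (_ : _ \o _ = fun x => tnth x i * (enorm x `^ -1)); last first.
  by apply/funext => x /=; rewrite tnth_mktuple powR_inv1// sqrtr_ge0.
apply: measurable_funM; first exact: measurable_tnth.
apply: (@measurableT_comp _ _ _ _ _ _ (@powR R ^~ (-1))).
  exact: measurable_powR.
exact: measurable_enorm.
Qed.

(* {r u | 0 < r <= 1, u in A, |u| = 1} *)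
Definition cone A : set (d.-tuple R) :=
  [set x | 0 < enorm x <= 1 /\ A (direction x)].

Lemma measurable_cone A : measurable A -> measurable (cone A).
Proof.
move=> mA; rewrite (_ : cone A = enorm @^-1` `]0, 1] `&` direction @^-1` A).
  apply: measurableI; rewrite -[X in measurable X]setTI.
    exact: measurable_enorm.
  exact: measurable_direction.
by apply/seteqP; split => x /=; rewrite in_itv.
Qed.

(* Surface measure on the unit sphere, as a measure on R^d carried by the
   sphere: it is the measure sigma of the polar decomposition
   dx = r^(d-1) dr dsigma, so that sigma(A) / d is the volume of the cone
   over A. For d = 1 it is the counting measure on {-1, 1}. *)
Definition surface_measure A : \bar R := (d%:R%:E * leb d (cone A))%E.

(* The surface measure rescaled to have total mass 1. *)
Definition sphere_prob A : \bar R :=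
  (((fine (surface_measure sphere))^-1)%:E * surface_measure A)%E.

Let leb_cone0 : leb d (cone set0) = 0%E.
Proof.
rewrite (_ : cone set0 = set0) ?measure0//.
by apply/seteqP; split => x // -[].
Qed.

Let leb_cone_sigma_additive :
  semi_sigma_additive (fun A => leb d (cone A)).
Proof.
move=> F mF tF mUF.
rewrite (_ : cone _ = \bigcup_k cone (F k)); last first.
  apply/seteqP; split => x.
    by move=> [x01 [k _ Fkx]]; exists k.
  by move=> [k _ [x01 Fkx]]; split=> //; exists k.
have mc k : measurable (cone (F k)) by exact: measurable_cone.
apply: measure_semi_sigma_additive => //; last exact: bigcup_measurable.
apply/trivIsetP => i j _ _ ij; rewrite -subset0 => x [[_ Fi] [_ Fj]].
by move/trivIsetP : tF => /(_ _ _ I I ij) /seteqP[/(_ (direction x) (conj Fi Fj))].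
Qed.

Let leb_cone_ge0 A : (0 <= leb d (cone A))%E. Proof. exact: measure_ge0. Qed.

Let leb_cone A := leb d (cone A).

HB.instance Definition _ := isMeasure.Build _ _ _ leb_cone
  leb_cone0 leb_cone_ge0 leb_cone_sigma_additive.

HB.instance Definition _ := Measure.copy surface_measure
  (mscale (d%:R)%:nng leb_cone).

Let mass_ge0 : 0 <= (fine (surface_measure sphere))^-1.
Proof. by rewrite invr_ge0 fine_ge0. Qed.

HB.instance Definition _ := Measure.copy sphere_prob
  (mscale (NngNum mass_ge0) surface_measure).

Definition gauss_density x : R := expR (- (pi * enorm x ^+ 2)).

Definition gauss_measure A : \bar R :=
  (\int[leb d]_(x in A) (gauss_density x)%:E)%E.

Lemma measurable_gauss_density :
  measurable_fun [set: d.-tuple R] gauss_density.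
Proof.
apply: measurableT_comp => //; apply: measurableT_comp => //.
apply: measurable_funM => //; apply: measurable_funX.
exact: measurable_enorm.
Qed.

Let gauss_measure0 : gauss_measure set0 = 0%E.
Proof. exact: integral_set0. Qed.

Let gauss_measure_ge0 A : (0 <= gauss_measure A)%E.
Proof. by apply: integral_ge0 => x _; rewrite lee_fin expR_ge0. Qed.

Let gauss_measure_sigma_additive : semi_sigma_additive gauss_measure.
Proof.
move=> F mF tF mUF; rewrite /gauss_measure ge0_integral_bigcup//=.
- apply: is_cvg_ereal_nneg_natsum_cond => n _ _.
  by apply: integral_ge0 => /= x ?; rewrite lee_fin expR_ge0.
- apply/measurable_EFinP; apply: measurable_funTS.
  exact: measurable_gauss_density.
- by move=> x _; rewrite lee_fin expR_ge0.
Qed.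

HB.instance Definition _ := isMeasure.Build _ _ _ gauss_measure
  gauss_measure0 gauss_measure_ge0 gauss_measure_sigma_additive.

End euclidean.

Section designs.
Context {R : realType} {d : nat}.

(* [msize f] is 1 + the total degree of [f], and 0 for [f = 0]. *)
Definition signed_spherical_design (t : nat) (X : {fset d.-tuple R})
    (w : X -> R) : Prop :=
  (forall x, x \in X -> sphere x) /\
  forall f : mpoly d R, (mpoly.msize f <= t.+1)%N ->
    ((\sum_(x : X) w x * meval (tnth (val x)) f)%R%:E =
     \int[sphere_prob]_(x in sphere) (meval (tnth x) f)%:E)%E.

Definition signed_gaussian_design (t : nat) (X : {fset d.-tuple R})
    (w : X -> R) : Prop :=
  forall f : mpoly d R, (mpoly.msize f <= t.+1)%N ->
    ((\sum_(x : X) w x * meval (tnth (val x)) f)%R%:E =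
     \int[gauss_measure]_x (meval (tnth x) f)%:E)%E.

End designs.

(* Main.v *)
Require Import Defs.
From HB Require Import structures.
From mathcomp Require Import all_boot all_order all_algebra finmap.
From mathcomp Require Import -(notations) mpoly.
From mathcomp Require Import all_classical all_reals all_analysis.
From mathcomp Require Import measurable_realfun ring lra zify.

(** The only feature of the two measures that enters the point count is their
invariance under the sign change of a single coordinate: it makes the moment
[M a] of the monomial [x ^ a] vanish as soon as some exponent [a j] is odd. So,
putting [k := t %/ 2], only the monomials [x ^ (2 b)] with [b] of total degree
at most [k] have to be matched, and there are about [d ^ k] of them.

The coefficient of such a monomial is extracted by finite differences. The
symmetric second difference [f (x + e_i) - 2 f x + f (x - e_i)] lowers degrees
by two and preserves parity in each variable; hence, applied at the origin
successively in the directions of a word [i_1 ... i_k], it kills every monomial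
of degree at most [2 k] except the square of [x_(i_1) ... x_(i_k)], on which it
is a nonzero constant ([diff_quad_monom_neq0], [central_diff_diag]). Being a
combination of [3 ^ k] evaluations, it costs a number of points independent of
[d], and summing over the [d ^ k] words, with weights given by the moments,
yields a signed quadrature with [(3 d) ^ k] points which is exact in degree
[2 k], zero in lower degrees, and zero on monomials with an odd exponent
([homog_quad]).

In the Gaussian case the degrees 0, 2, ..., [2 k] are treated one after the
other: the quadrature of degree [2 j] corrects the error left in that degree by
the previous ones without disturbing the lower degrees ([graded_quad]).

On the sphere, only degree [2 k] is needed, since multiplying by
[x_1 ^ 2 + ... + x_d ^ 2 = 1] raises every smaller even degree to [2 k]. The
points of [homog_quad] are projected radially, which for a homogeneous
polynomial of degree [2 k] amounts to multiplying the weight at [x] by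
[|x| ^ (2 k)]; averaging with the antipodal points then takes care of the odd
degrees ([sphere_quad]).

What remains is analytic: Lebesgue measure on tuples is invariant under the
sign changes ([leb_mirror]), hence so are both measures, and polynomials are
integrable for both ([integrable_monom_gauss], [integrable_monom_sphere]). *)

Set Implicit Arguments.
Unset Strict Implicit.
Unset Printing Implicit Defensive.

Import Order.TTheory GRing.Theory Num.Theory.

Local Open Scope fset_scope.
Local Open Scope ring_scope.

(** * Signed quadratures as weighted lists of points *)

Section quadrature.
Context {R : realType} {T : Type}.
Implicit Types (F : seq (R * T)) (f : T -> R).

Definition quad F f : R := \sum_(p <- F) p.1 * f p.2.

Lemma quad_cat F G f : quad (F ++ G) f = quad F f + quad G f.
Proof. exact: big_cat. Qed.

Lemma quad_flatten (I : Type) (r : seq I) (F : I -> seq (R * T)) f :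
  quad (flatten [seq F i | i <- r]) f = \sum_(i <- r) quad (F i) f.
Proof. by rewrite /quad big_flatten big_map. Qed.

Lemma eq_quad F f g : f =1 g -> quad F f = quad F g.
Proof. by move=> fg; apply: eq_bigr => p _; rewrite fg. Qed.

Lemma quad_sum (I : Type) (r : seq I) F (f : I -> T -> R) :
  quad F (fun x => \sum_(i <- r) f i x) = \sum_(i <- r) quad F (f i).
Proof.
by rewrite /quad exchange_big; apply: eq_bigr => p _; rewrite mulr_sumr.
Qed.

Lemma quadZ F c f : quad F (fun x => c * f x) = c * quad F f.
Proof. by rewrite mulr_sumr; apply: eq_bigr => p _; rewrite mulrCA. Qed.

Definition scale_quad (c : R) F := [seq (c * p.1, p.2) | p <- F].

Lemma quad_scale c F f : quad (scale_quad c F) f = c * quad F f.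
Proof.
by rewrite /quad big_map mulr_sumr; apply: eq_bigr => p _; rewrite mulrA.
Qed.

End quadrature.

Section quad_fset.
Context {R : realType} {T : choiceType}.

(** A list may contain the same point several times; in the finite set its
weights are added up, so that the list length still bounds the number of
points. *)
Lemma quad_fset (F : seq (R * T)) : exists (X : {fset T}) (w : X -> R),
  [/\ (#|` X| <= size F)%N,
      (forall x, x \in X -> exists2 p, p \in F & x = p.2) &
      forall f, \sum_(x : X) w x * f (val x) = quad F f].
Proof.
pose X := [fset x in [seq p.2 | p <- F]]%fset.
exists X, (fun x => \sum_(p <- F | p.2 == val x) p.1); split.
- by rewrite card_fseq (leq_trans (size_undup _))// size_map.
- by move=> x; rewrite !inE => /mapP.
- move=> f; under eq_bigr do rewrite mulr_suml.
  rewrite (exchange_big_dep predT)//= /quad big_seq [RHS]big_seq.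
  apply: eq_bigr => p pF.
  have pX : p.2 \in X by rewrite !inE; apply/mapP; exists p.
  by rewrite (big_pred1 [` pX]%fset)// => x /=; rewrite eq_sym -val_eqE.
Qed.

End quad_fset.


(** * Iterated second differences of a power at 0 *)

Section univariate.
Context {R : realType}.
Implicit Types (g : R -> R) (m a : nat).

Definition second_diff g : R -> R := fun x => g (x + 1) - 2 * g x + g (x - 1).

(** The [2 m]-th central difference of [x ^ a] at 0. *)
Definition central_diff m a : R :=
  iter m second_diff (fun x => x ^+ a) 0.

Lemma second_diff_sum (n : nat) (c : 'I_n -> R) (f : 'I_n -> R -> R) m x :
  iter m second_diff (fun y => \sum_i c i * f i y) x =
  \sum_i c i * iter m second_diff (f i) x.
Proof.
elim: m x => //= m IHm x.
rewrite {1}/second_diff !IHm mulr_sumr -sumrB -big_split/=.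
by apply: eq_bigr => i _; rewrite /second_diff; ring.
Qed.

(** The terms with [a - i] odd cancel, which is why degrees drop by two and the
parity of the exponent is preserved; the next lemmas are all read off this
expansion. *)
Lemma second_diff_exp a (x : R) : second_diff (fun y => y ^+ a) x =
  \sum_(i < a) ('C(a, i)%:R * (1 + (-1) ^+ (a - i))) * x ^+ i.
Proof.
rewrite /second_diff [x + 1]addrC [x - 1]addrC addrAC !exprDn -big_split/=.
rewrite big_ord_recr/= subnn binn !expr0 !mul1r !mulr1n.
rewrite mulr_natl mulr2n addrK; apply: eq_bigr => i _.

by rewrite expr1n mul1r -mulr_natl -[_ *+ 'C(a, i)]mulr_natl; ring.
Qed.

Lemma central_diffS m a : central_diff m.+1 a =
  \sum_(i < a) ('C(a, i)%:R * (1 + (-1) ^+ (a - i))) * central_diff m i.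
Proof.
rewrite {1}/central_diff iterSr -second_diff_sum; congr (iter m _ _ 0).
by apply/funext => x; exact: second_diff_exp.
Qed.

(** By parity: an odd power expands into odd powers, which vanish at 0. *)
Lemma central_diff_odd m a : odd a -> central_diff m a = 0.
Proof.
elim: m a => [|m IHm] a oa; first by rewrite /central_diff/= expr0n; case: a oa.
rewrite central_diffS big1// => i _; have [/IHm ->|ei] := boolP (odd i).
  by rewrite mulr0.
rewrite -signr_odd oddB ?(ltnW (ltn_ord i))// oa (negbTE ei)/= expr1 subrr.
by rewrite mulr0 mul0r.
Qed.

Lemma central_diff_low m a : (a < m.*2)%N -> central_diff m a = 0.
Proof.
elim: m a => // m IHm a; rewrite doubleS ltnS => am.
rewrite central_diffS big1// => i _.
have [/IHm ->|mi] := ltnP i m.*2; first by rewrite mulr0.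
have -> : (a - i = 1)%N by have := ltn_ord i; lia.
by rewrite expr1 subrr mulr0 mul0r.
Qed.

Lemma central_diff_diag m : central_diff m m.*2 != 0.
Proof.
elim: m => [|m IHm]; first by rewrite /central_diff/= expr0 oner_neq0.
rewrite central_diffS !big_ord_recr/= big1 => [|i _]; last first.
  by rewrite central_diff_low ?mulr0.
rewrite subSnn expr1 subrr mulr0 mul0r addr0 add0r !subSn// subnn sqrrN expr1n.
by rewrite !mulf_neq0// pnatr_eq0 -lt0n bin_gt0 ltnW.
Qed.

End univariate.

(** * Second differences along the coordinate axes *)

Section differences.
Context {R : realType} {d : nat}.
Implicit Types (x : d.-tuple R) (i : 'I_d) (s : seq 'I_d) (a : 'I_d -> nat).

Definition translate i (c : R) x : d.-tuple R :=
  [tuple tnth x j + (if j == i then c else 0) | j < d].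

(** The second differences in the directions of the word [s], evaluated at the
origin, as a weighted list of points: each direction replaces a point [x] by
[x + e_i], [x] and [x - e_i] with weights 1, -2 and 1. *)
Fixpoint diff_quad s : seq (R * d.-tuple R) :=
  if s is i :: s' then
    flatten [seq [:: (p.1, translate i 1 p.2); (- 2 * p.1, p.2);
                     (p.1, translate i (-1) p.2)] | p <- diff_quad s']
  else [:: (1, [tuple 0 | _ < d])].

Definition monom a x : R := \prod_(j < d) tnth x j ^+ a j.

Lemma size_diff_quad s : size (diff_quad s) = (3 ^ size s)%N.
Proof.
elim: s => //= i s IHs; rewrite expnS -IHs.
by elim: (diff_quad s) => //= p F ->; rewrite mulnS.
Qed.

(** A difference in direction [e_i] only acts on the [i]-th factor of a product
of univariate functions, so the iterated difference factors too. *)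
Lemma diff_quad_prod s (g : 'I_d -> R -> R) :
  quad (diff_quad s) (fun x => \prod_(j < d) g j (tnth x j)) =
  \prod_(j < d) iter (count_mem j s) second_diff (g j) 0.
Proof.
elim: s g => [|i s IHs] g.
  rewrite /quad big_seq1 mul1r; apply: eq_bigr => j _.
  by rewrite tnth_mktuple.
pose h j := if j == i then second_diff (g i) else g j.
transitivity (quad (diff_quad s) (fun x => \prod_(j < d) h j (tnth x j))).
  rewrite quad_flatten; apply: eq_bigr => -[w x] _.
  have E c : \prod_(j < d) g j (tnth (translate i c x) j) =
      g i (tnth x i + c) * \prod_(j < d | j != i) g j (tnth x j).
    rewrite (bigD1 i)//= tnth_mktuple eqxx; congr (_ * _).
    by apply: eq_bigr => j /negbTE ji; rewrite tnth_mktuple ji addr0.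
  rewrite /quad !big_cons big_nil/= addr0 !E.
  rewrite [X in - 2 * w * X](bigD1 i)//= [X in _ = w * X](bigD1 i)//=.
  rewrite [X in _ = w * (_ * X)](eq_bigr (fun j => g j (tnth x j))).
    by rewrite /h eqxx /second_diff; ring.
  by move=> j /negbTE ji; rewrite /h ji.
rewrite IHs; apply: eq_bigr => j _; rewrite /= [i == j]eq_sym /h.
by case: eqVneq => [->|_]/=; rewrite ?add0n// -iterSr.
Qed.

Lemma diff_quad_monom s a : quad (diff_quad s) (monom a) =
  \prod_(j < d) central_diff (count_mem j s) (a j).
Proof. exact: diff_quad_prod. Qed.

Lemma sum_count_mem s : (\sum_(j < d) count_mem j s = size s)%N.
Proof.
elim: s => [|i s IHs]/=; first by rewrite big1.
rewrite big_split/= IHs (bigD1 i)//= eqxx big1 ?addn0// => j /negbTE.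
by rewrite eq_sym => ->.
Qed.

(** By [central_diff_low] each exponent is at least twice the multiplicity of
its variable in [s]; the bound on the total degree leaves no room for a strict
inequality. *)
Lemma diff_quad_monom_neq0 s a : (\sum_j a j <= (size s).*2)%N ->
  quad (diff_quad s) (monom a) != 0 -> forall j, a j = (count_mem j s).*2.
Proof.
rewrite diff_quad_monom => as2 /prodf_neq0/= ne0.
have le_a j : ((count_mem j s).*2 <= a j)%N.
  rewrite leqNgt; apply/negP => /(@central_diff_low R) E.
  by have := ne0 j isT; rewrite E eqxx.
move=> j; apply/eqP; rewrite eqn_leq le_a andbT leqNgt; apply/negP => lt_a.
move: as2; rewrite leqNgt => /negP; apply.
rewrite -sum_count_mem -[X in (X < _)%N]muln2 big_distrl/=.
rewrite (bigD1 j)//= [X in (_ < X)%N](bigD1 j)//= -addSn leq_add//.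
  by rewrite muln2.
by apply: leq_sum => i _; rewrite muln2.
Qed.

End differences.

(** * Quadratures with prescribed even moments *)

Section homogeneous.
Context {R : realType} {d : nat}.
Implicit Types (k : nat) (M : ('I_d -> nat) -> R) (a : 'I_d -> nat).

Definition doubled_mult (s : seq 'I_d) : 'I_d -> nat :=
  fun j => (count_mem j s).*2.

(** The words with the same letter multiplicities detect the same monomial; the
cardinal divides its moment evenly among them. *)
Definition word_weight k M (s : k.-tuple 'I_d) : R :=
  M (doubled_mult s) / (#|[pred s' : k.-tuple 'I_d | perm_eq s' s]|%:R *
    \prod_j central_diff (count_mem j s) (count_mem j s).*2).

Definition homog_quad k M : seq (R * d.-tuple R) :=
  flatten [seq scale_quad (word_weight M s) (diff_quad s)
          | s <- enum {: k.-tuple 'I_d}].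

Lemma size_homog_quad k M : size (homog_quad k M) = (3 ^ k * d ^ k)%N.
Proof.
rewrite size_flatten /shape -map_comp sumnE big_map big_enum/=.
rewrite (eq_bigr (fun=> (3 ^ k)%N)) => [|s _].
  by rewrite sum_nat_const card_tuple card_ord mulnC.
by rewrite size_map size_diff_quad size_tuple.
Qed.

Lemma quad_homog_quad k M f : quad (homog_quad k M) f =
  \sum_(s : k.-tuple 'I_d) word_weight M s * quad (diff_quad s) f.
Proof.
rewrite quad_flatten big_enum; apply: eq_bigr => s _; exact: quad_scale.
Qed.

Lemma homog_quad_odd k M a : (exists j, odd (a j)) ->
  quad (homog_quad k M) (monom a) = 0.
Proof.
move=> [j oj]; rewrite quad_homog_quad; apply: big1 => s _.
by rewrite diff_quad_monom (bigD1 j)//= central_diff_odd// mul0r mulr0.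
Qed.

Lemma homog_quad_low k M a : (\sum_j a j < k.*2)%N ->
  quad (homog_quad k M) (monom a) = 0.
Proof.
move=> ak; rewrite quad_homog_quad big1// => s _.
have [->|ne0] := eqVneq (quad (diff_quad s) (monom a)) (0 : R).
  by rewrite mulr0.
have as2 : (\sum_j a j <= (size s).*2)%N.
  by rewrite size_tuple ltnW.
have E := diff_quad_monom_neq0 as2 ne0.
move: ak; under eq_bigr do rewrite E -muln2.
by rewrite -big_distrl/= sum_count_mem size_tuple muln2 ltnn.
Qed.

Lemma perm_eq_count_mem (s t : seq 'I_d) :
  (forall j, count_mem j s = count_mem j t) -> perm_eq s t.
Proof. by move=> st; apply/allP => j _; apply/eqP; exact: st. Qed.

(** Only the words with letter multiplicities [a / 2] see the monomial [a], and
each of them contributes the same share of [M a]. *)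
Lemma homog_quad_exact k M a :
    (forall a, (exists j, odd (a j)) -> M a = 0) -> (\sum_j a j)%N = k.*2 ->
  quad (homog_quad k M) (monom a) = M a.
Proof.
move=> M0 ak; have [/existsP oa|] := boolP [exists j, odd (a j)].
  by rewrite homog_quad_odd// M0.
move=> /existsPn ea; have {}ea j : a j = (a j)./2.*2.
  by rewrite -[LHS]odd_double_half (negbTE (ea j)).
(* A word detecting the monomial [a], so that the number of such words by which
   [word_weight] divides is not 0. *)
pose w := flatten [seq nseq (a j)./2 j | j <- enum 'I_d].
have cw j : count_mem j w = (a j)./2.
  rewrite /w count_flatten -map_comp sumnE big_map big_enum/= (bigD1 j)//=.
  rewrite count_nseq/= eqxx mul1n big1 ?addn0// => i /negbTE ij.
  by rewrite count_nseq/= ij.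
have sw : size w == k.
  rewrite -sum_count_mem -(inj_eq double_inj) -ak -muln2 big_distrl/=.
  by apply/eqP/eq_bigr => j _; rewrite cw muln2 -ea.
pose s0 : k.-tuple 'I_d := Tuple sw.
pose N : nat := #|[pred s' : k.-tuple 'I_d | perm_eq s' s0]|.
have N0 : N%:R != 0 :> R.
  by rewrite pnatr_eq0 -lt0n; apply/card_gt0P; exists s0; rewrite inE.
rewrite quad_homog_quad (bigID [pred s : k.-tuple 'I_d | perm_eq s s0])/=.
rewrite [X in _ + X]big1 ?addr0 => [|s ns]; last first.
  have [->|ne0] := eqVneq (quad (diff_quad s) (monom a)) (0 : R).
    by rewrite mulr0.
  have as2 : (\sum_j a j <= (size s).*2)%N.
    by rewrite size_tuple ak.
  have E := diff_quad_monom_neq0 as2 ne0.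
  case/negP: ns; apply: perm_eq_count_mem => j.
  by rewrite /= cw E doubleK.
rewrite (eq_bigr (fun=> M a / N%:R)) => [|s ps].
  by rewrite sumr_const -[LHS]mulr_natr mulfVK.
have cs j : count_mem j s = (a j)./2 by rewrite -cw; exact/permP.
have -> : word_weight M s = M a / (N%:R *
    \prod_j central_diff (count_mem j s) (count_mem j s).*2).
  rewrite /word_weight; congr (M _ / (_%:R * _)).
    by apply/funext => j; rewrite /doubled_mult cs -ea.
  apply: eq_card => s'; rewrite !inE; apply/idP/idP => H.
    exact: perm_trans H ps.
  by rewrite (perm_trans H)// perm_sym.
rewrite diff_quad_monom.
under [X in _ * X]eq_bigr => j _ do rewrite (ea j) -cs.
rewrite invfM mulrA mulfVK//.
by apply/prodf_neq0 => j _; exact: central_diff_diag.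
Qed.

End homogeneous.

Section graded.
Context {R : realType} {d : nat}.
Implicit Types (M : ('I_d -> nat) -> R) (a : 'I_d -> nat).

(** [homog_quad j] vanishes in degrees below [2 j] but not above: it is used to
correct, in degree [2 j], the error made there by the lower stages, which then
remain exact in their own degrees. *)
Fixpoint graded_quad M k : seq (R * d.-tuple R) :=
  if k is k'.+1 then
    let F := graded_quad M k' in
    F ++ homog_quad k (fun a => M a - quad F (monom a))
  else homog_quad 0 M.

Lemma size_graded_quad M k : (0 < d)%N ->
  (size (graded_quad M k) <= k.+1 * 3 ^ k * d ^ k)%N.
Proof.
move=> d0; elim: k => [|k IHk]/=; first by rewrite size_homog_quad.
rewrite size_cat size_homog_quad -mulnA mulSn addnC leq_add2l mulnA.
rewrite (leq_trans IHk)// -2!mulnA leq_mul2l leq_mul ?orbT//.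
  by rewrite leq_exp2l.
by rewrite leq_pexp2l.
Qed.

Lemma graded_quad_odd M k a : (exists j, odd (a j)) ->
  quad (graded_quad M k) (monom a) = 0.
Proof.
move=> oa; elim: k => [|k IHk]; first exact: homog_quad_odd.
by rewrite quad_cat IHk homog_quad_odd ?addr0.
Qed.

Lemma graded_quad_exact M k a :
    (forall a, (exists j, odd (a j)) -> M a = 0) ->
    (\sum_j a j <= k.*2.+1)%N ->
  quad (graded_quad M k) (monom a) = M a.
Proof.
move=> M0 ak; have [/existsP oa|] := boolP [exists j, odd (a j)].
  by rewrite graded_quad_odd// M0.
move=> /existsPn ea.
have {ea} : ~~ odd (\sum_j a j).
  by rewrite (big_morph odd oddD (erefl _)) big1// => j _; exact/negbTE.
elim: k ak => [|k IHk] ak es; first by apply: homog_quad_exact => //; lia.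
rewrite quad_cat; have [ak'|ak'] := leqP (\sum_j a j) k.*2.+1.
  by rewrite IHk// homog_quad_low ?addr0//; lia.
rewrite homog_quad_exact ?subrKC//; last by lia.
by move=> b ob; rewrite graded_quad_odd// M0// subr0.
Qed.

End graded.

(** * Quadratures on the sphere *)

Section sphere_quad.
Context {R : realType} {d : nat}.
Implicit Types (x : d.-tuple R) (F : seq (R * d.-tuple R)) (a : 'I_d -> nat).

Lemma enorm_sqr x : enorm x ^+ 2 = \sum_(i < d) tnth x i ^+ 2.
Proof. by rewrite sqr_sqrtr// sumr_ge0// => i _; exact: sqr_ge0. Qed.

Lemma enorm_eq0 x : enorm x = 0 -> forall i, tnth x i = 0.
Proof.
move=> x0 i; have := enorm_sqr x; rewrite x0 expr0n/= => /esym/eqP.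
rewrite psumr_eq0 => [/allP|j _]; last exact: sqr_ge0.
by move=> /(_ i (mem_index_enum _)); rewrite sqrf_eq0 => /eqP.
Qed.

Lemma enorm1P x : \sum_(i < d) tnth x i ^+ 2 = 1 -> sphere x.
Proof. by rewrite /sphere/= /enorm => ->; exact: sqrtr1. Qed.

Lemma sphere_direction x : enorm x != 0 -> sphere (direction x).
Proof.
move=> x0; apply: enorm1P.
under eq_bigr do rewrite tnth_mktuple expr_div_n.
by rewrite -mulr_suml -enorm_sqr divff// expf_neq0.
Qed.

Definition basis_vector (i : 'I_d) : d.-tuple R := [tuple (j == i)%:R | j < d].

Lemma sphere_basis_vector i : sphere (basis_vector i).
Proof.
apply: enorm1P; rewrite (bigD1 i)//= tnth_mktuple eqxx expr1n big1 ?addr0//.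
by move=> j /negbTE ji; rewrite tnth_mktuple ji expr0n.
Qed.

Definition antipode x : d.-tuple R := [tuple - tnth x j | j < d].

Lemma sphere_antipode x : sphere x -> sphere (antipode x).
Proof.
rewrite /sphere/= /enorm => x1; rewrite -[RHS]x1; congr Num.sqrt.
by apply: eq_bigr => j _; rewrite tnth_mktuple sqrrN.
Qed.

Lemma monom_antipode a x :
  monom a (antipode x) = (-1) ^+ (\sum_j a j) * monom a x.
Proof.
rewrite -prodrXr /monom -big_split/=; apply: eq_bigr => j _.
by rewrite tnth_mktuple [LHS]exprNn.
Qed.

Lemma monom_direction a x : enorm x != 0 ->
  enorm x ^+ (\sum_j a j) * monom a (direction x) = monom a x.
Proof.
move=> x0; rewrite -prodrXr /monom -big_split/=; apply: eq_bigr => j _.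
by rewrite tnth_mktuple expr_div_n mulrCA divff ?mulr1// expf_neq0.
Qed.

Lemma monom_eq0 a x : enorm x = 0 -> (0 < \sum_j a j)%N -> monom a x = 0.
Proof.
move=> /enorm_eq0 x0; rewrite lt0n sum_nat_eq0 => /forallPn[j]/= aj.
by rewrite /monom (bigD1 j)//= x0 expr0n (negbTE aj) mul0r.
Qed.

Variable i0 : 'I_d.

(** The origin, which [homog_quad] may contain, has no direction; an arbitrary
point of the sphere is used for it. *)
Definition to_sphere x := if enorm x == 0 then basis_vector i0 else direction x.

Lemma sphere_to_sphere x : sphere (to_sphere x).
Proof.
rewrite /to_sphere; case: eqVneq => x0; first exact: sphere_basis_vector.
exact: sphere_direction.
Qed.

(** Homogeneity. It also holds at the origin: in positive degree both sides are
0, and in degree 0 both are 1, as [0 ^+ 0 = 1]; thus [k = 0] is no exception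
below. *)
Lemma monom_to_sphere a x :
  enorm x ^+ (\sum_j a j) * monom a (to_sphere x) = monom a x.
Proof.
rewrite /to_sphere; case: eqVneq => [x0|]; last exact: monom_direction.
rewrite x0 expr0n; case: posnP => [a0|a0]; last by rewrite mul0r monom_eq0.
rewrite mul1r /monom !big1// => j _;
by move/eqP: a0; rewrite sum_nat_eq0 => /forallP/(_ j)/= /eqP ->.
Qed.

Definition radial_quad n F :=
  [seq (p.1 * enorm p.2 ^+ n, to_sphere p.2) | p <- F].

Definition antipodal_quad F :=
  scale_quad 2^-1 (F ++ [seq (p.1, antipode p.2) | p <- F]).

Lemma quad_radial n F a : (\sum_j a j)%N = n ->
  quad (radial_quad n F) (monom a) = quad F (monom a).
Proof.
move=> an; rewrite /quad big_map; apply: eq_bigr => p _ /=.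
by rewrite -mulrA -an monom_to_sphere.
Qed.

Lemma quad_antipodal F a : quad (antipodal_quad F) (monom a) =
  (~~ odd (\sum_j a j))%:R * quad F (monom a).
Proof.
rewrite quad_scale quad_cat [X in _ + X]/quad big_map.
under [X in _ + X]eq_bigr do rewrite monom_antipode mulrCA.
rewrite -mulr_sumr -/(quad F (monom a)) -signr_odd.
by case: odd; rewrite ?expr0 ?expr1 /=; field.
Qed.

Definition sphere_quad (M : ('I_d -> nat) -> R) k :=
  antipodal_quad (radial_quad k.*2 (homog_quad k M)).

Lemma size_sphere_quad M k : size (sphere_quad M k) = (2 * (3 ^ k * d ^ k))%N.
Proof. by rewrite size_map size_cat !size_map size_homog_quad mul2n addnn. Qed.

Lemma sphere_sphere_quad M k p : p \in sphere_quad M k -> sphere p.2.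
Proof.
move=> /mapP[q + ->]/=; rewrite mem_cat => /orP[/mapP[r _ ->]/=|].
  exact: sphere_to_sphere.
by move=> /mapP[_ /mapP[r _ ->] ->]/=; exact/sphere_antipode/sphere_to_sphere.
Qed.

(** The exponent of [x_c ^ 2 * x ^ a]. *)
Definition bump2 a c : 'I_d -> nat := fun j => (a j + (j == c).*2)%N.

Lemma sum_bump2 a c : (\sum_j bump2 a c j = (\sum_j a j).+2)%N.
Proof.
rewrite big_split/= -addn2; congr (_ + _)%N.
by rewrite (bigD1 c)//= eqxx big1// => j /negbTE ->.
Qed.

Lemma monom_bump2 a c x : monom (bump2 a c) x = tnth x c ^+ 2 * monom a x.
Proof.
rewrite /monom (bigD1 c)//= [in RHS](bigD1 c)//= /bump2 eqxx addn2 !exprS.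
rewrite expr0 mulr1 -!mulrA; congr (_ * (_ * (_ * _))).
by apply: eq_bigr => j /negbTE ->; rewrite addn0.
Qed.

Lemma sum_monom_bump2 a x : sphere x -> \sum_c monom (bump2 a c) x = monom a x.
Proof.
move=> x1; under eq_bigr do rewrite monom_bump2.
by rewrite -mulr_suml -enorm_sqr x1 expr1n mul1r.
Qed.

(** Multiplying a monomial by [x_1 ^ 2 + ... + x_d ^ 2 = 1] relates its
value in [M], by the second hypothesis, and under the quadrature, whose points
are on the sphere, to monomials of degree two more in the same way; even
degrees thus climb up to [2 k]. In odd degrees both sides vanish, the
quadrature by antipodal symmetry. *)
Lemma sphere_quad_exact M k a :
    (forall a, (exists j, odd (a j)) -> M a = 0) ->
    (forall a, M a = \sum_c M (bump2 a c)) ->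
    (\sum_j a j <= k.*2.+1)%N ->
  quad (sphere_quad M k) (monom a) = M a.
Proof.
move=> M0 Mbump ak; have [oa|ea] := boolP (odd (\sum_j a j)).
  rewrite quad_antipodal oa mul0r M0//; apply/existsP; apply: contraLR oa.
  move=> /existsPn ea; rewrite (big_morph odd oddD (erefl _)) big1// => j _.
  exact/negbTE.
have [n] := ubnP (k.*2 - \sum_j a j).
elim: n a ak ea => // n IHn a ak ea an.
have [aE|ak'] := eqVneq (\sum_j a j)%N k.*2.
  by rewrite quad_antipodal ea mul1r quad_radial// homog_quad_exact.
have {}ak' : (\sum_j a j < k.*2)%N.
  rewrite ltn_neqAle ak' -ltnS ltn_neqAle ak andbT.
  by apply: contraNneq ea => ->; rewrite /= odd_double.
have IH c : quad (sphere_quad M k) (monom (bump2 a c)) = M (bump2 a c).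
  apply: IHn; rewrite sum_bump2/= ?negbK// -ltnS (leq_trans _ an)//.
  by rewrite ltnS ltn_sub2l.
rewrite Mbump -(eq_bigr _ (fun c _ => IH c)) -quad_sum /quad !big_seq.
apply: eq_bigr => p pF.
by rewrite sum_monom_bump2//; exact: sphere_sphere_quad pF.
Qed.

End sphere_quad.

Local Open Scope classical_set_scope.

(** * Integration against a density *)

Section density.
Context d (T : measurableType d) (R : realType).
Variables (mu nu : {measure set T -> \bar R}) (g : T -> R).
Hypotheses (mg : measurable_fun setT g) (g0 : forall x, 0 <= g x).
Hypothesis nuE : forall A, measurable A ->
  nu A = (\int[mu]_(x in A) (g x)%:E)%E.

Import HBNNSimple.
Local Open Scope ereal_scope.

Lemma integral_density_nnsfun (h : {nnsfun T >-> R}) :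
  \int[nu]_x (h x)%:E = \int[mu]_x ((h x)%:E * (g x)%:E).
Proof.
have mh r : measurable (h @^-1` [set r]) by [].
transitivity (\sum_(r \in range h) \int[nu]_x (r * \1_(h @^-1` [set r]) x)%:E).
  rewrite -ge0_integral_fsum//.
  - by apply: eq_integral => x _; rewrite fsumEFin// -fimfunE.
  - by move=> r; exact/measurable_EFinP/measurable_funM.
  - by move=> r x _; rewrite nnfun_muleindic_ge0.
transitivity (\sum_(r \in range h)
    \int[mu]_x ((r * \1_(h @^-1` [set r]) x)%:E * (g x)%:E)).
  apply: eq_fsbigr => r /[!inE] -[y _ <-].
  rewrite integralZl_indic_nnsfun// integral_indic// setIT nuE//.
  rewrite integral_mkcond -ge0_integralZl_EFin//=.
  - apply: eq_integral => x _; rewrite patchE indicE.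
    by case: (x \in _); rewrite ?mulr1 ?mulr0 ?mule0 ?mul0e.
  - by move=> x _; rewrite patchE; case: ifPn => // _; rewrite lee_fin.
  - apply/(measurable_restrictT _ _).1 => //.
    by apply/measurable_EFinP; exact: measurable_funTS.
rewrite -ge0_integral_fsum//.
- apply: eq_integral => x _; rewrite -ge0_mule_fsuml; last first.
    by move=> r; rewrite nnfun_muleindic_ge0.
  by rewrite fsumEFin// -fimfunE.
- move=> r; apply: emeasurable_funM; last exact/measurable_EFinP.
  exact/measurable_EFinP/measurable_funM.
- by move=> r x _; rewrite mule_ge0 ?nnfun_muleindic_ge0// lee_fin.
Qed.

(** Monotone approximation by simple functions. *)
Lemma integral_density (f : T -> \bar R) :
    measurable_fun setT f -> (forall x, 0 <= f x) ->
  \int[nu]_x f x = \int[mu]_x (f x * (g x)%:E).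
Proof.
move=> mf f0; pose f_ := nnsfun_approx measurableT mf.
have cf x : (EFin \o f_^~ x) n @[n --> \oo] --> f x.
  by apply: cvg_nnsfun_approx => // y _; exact: f0.
have fg x : (f_ n x)%:E * (g x)%:E @[n --> \oo] --> f x * (g x)%:E.
  by apply: cvgeZr => //; exact: cf.
transitivity (limn (fun n => \int[nu]_x (f_ n x)%:E)).
  rewrite -monotone_convergence//.
  - by apply: eq_integral => x _; apply/esym/cvg_lim => //; exact: cf.
  - by move=> n; exact/measurable_EFinP/measurable_funP.
  - by move=> n x _; rewrite lee_fin.
  - by move=> x _ m n mn; rewrite lee_fin; exact/lefP/nd_nnsfun_approx.
under eq_fun do rewrite integral_density_nnsfun.
rewrite -monotone_convergence//.
- by apply: eq_integral => x _; apply/cvg_lim => //; exact: fg.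
- by move=> n; apply: emeasurable_funM; apply/measurable_EFinP.
- by move=> n x _; rewrite mule_ge0// lee_fin.
- move=> x _ m n mn; rewrite lee_wpmul2r ?lee_fin//.
  exact/lefP/nd_nnsfun_approx.
Qed.

Lemma integrable_density (C : R) (f h : T -> R) :
    measurable_fun setT f -> measurable_fun setT h -> (forall x, 0 <= h x)%R ->
    (0 <= C)%R -> (forall x, `|f x| * g x <= C * h x)%R ->
    \int[mu]_x (h x)%:E < +oo ->
  nu.-integrable setT (EFin \o f).
Proof.
move=> mf mh h0 C0 fgh ih; apply/integrableP; split.
  exact/measurable_EFinP.
have mnf : measurable_fun setT (fun x => `|(f x)%:E|).
  by apply: measurableT_comp => //; exact/measurable_EFinP.
rewrite integral_density//.
apply: (@le_lt_trans _ _ (\int[mu]_x (C%:E * (h x)%:E))).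
  apply: ge0_le_integral => //.
  - by move=> x _; rewrite mule_ge0// lee_fin.
  - by apply: emeasurable_funM => //; exact/measurable_EFinP.
  - by apply: emeasurable_funM => //; exact/measurable_EFinP.
  - by move=> x _; rewrite -!EFinM lee_fin.
rewrite ge0_integralZl//.
- exact: lte_mul_pinfty.
- exact/measurable_EFinP.
- by move=> x _; rewrite lee_fin.
Qed.

End density.

(** * Invariance under coordinate sign changes *)

Section measure_preserving.
Local Open Scope ereal_scope.
Context d (T : measurableType d) (R : realType).
Variables (mu : {measure set T -> \bar R}) (phi : T -> T).
Hypothesis mphi : measurable_fun setT phi.
Hypothesis phi_preserving : forall A, measurable A -> mu (phi @^-1` A) = mu A.
Let mphi_mixin := isMeasurableFun.Build _ _ _ _ _ mphi.
Let phi_mfun : {mfun _ >-> _} := HB.pack phi mphi_mixin.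

Let integral_pushforward_preserving D (h : T -> \bar R) :
  \int[pushforward mu phi_mfun]_(x in D) h x = \int[mu]_(x in D) h x.
Proof. by apply: eq_measure_integral => A mA _; exact: phi_preserving. Qed.

Lemma ge0_integral_preserving D (h : T -> \bar R) :
    measurable D -> measurable_fun D h -> {in D, forall x, 0 <= h x} ->
  \int[mu]_(x in phi @^-1` D) h (phi x) = \int[mu]_(x in D) h x.
Proof.
move=> mD mh h0; rewrite -[RHS]integral_pushforward_preserving.
exact/esym/ge0_integral_pushforward.
Qed.

Lemma integral_preserving D (h : T -> \bar R) :
    measurable D -> measurable_fun setT h ->
    mu.-integrable (phi @^-1` D) (h \o phi) ->
  \int[mu]_(x in phi @^-1` D) h (phi x) = \int[mu]_(x in D) h x.
Proof.
move=> mD mh ih; rewrite -[RHS]integral_pushforward_preserving.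
exact/esym/integral_pushforward.
Qed.

End measure_preserving.

Section product_preserving.
Local Open Scope ereal_scope.
Context d1 d2 (T1 : measurableType d1) (T2 : measurableType d2) (R : realType).
Variables (m1 : {sigma_finite_measure set T1 -> \bar R})
          (m2 : {sigma_finite_measure set T2 -> \bar R}).
Variables (f : T1 -> T1) (g : T2 -> T2).
Hypothesis mf : measurable_fun setT f.
Hypothesis f_preserving : forall A, measurable A -> m1 (f @^-1` A) = m1 A.
Hypothesis g_preserving : forall A, measurable A -> m2 (g @^-1` A) = m2 A.

(** The section of the preimage of [A] at [x] is the preimage by [g] of the
section of [A] at [f x]: [g] disappears from the inner measure and [f] from the
outer integral. *)
Lemma product_preserving A : measurable A ->
  (m1 \x m2) ((fun p => (f p.1, g p.2)) @^-1` A) = (m1 \x m2) A.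
Proof.
move=> mA; rewrite /= /product_measure1.
have -> : m2 \o xsection ((fun p => (f p.1, g p.2)) @^-1` A) =
          (m2 \o xsection A) \o f.
  apply/funext => x /=; rewrite -[RHS]g_preserving; last first.
    exact: measurable_xsection.
  by congr (m2 _); apply/seteqP; split => y; rewrite /xsection/= !inE.
rewrite -[in LHS](preimage_setT f).
apply: (ge0_integral_preserving (mu := m1) mf f_preserving) => //.
  exact: measurable_fun_xsection.
by move=> x _ /=; exact: (measure_ge0 m2).
Qed.

End product_preserving.

Section reflection.
Context {R : realType}.

(** The sign change of the coordinate [c]. *)
Definition mirror d (c : 'I_d) (x : d.-tuple R) : d.-tuple R :=
  [tuple if j == c then - tnth x j else tnth x j | j < d].

Lemma measurable_mirror d (c : 'I_d) :
  measurable_fun [set: d.-tuple R] (mirror c).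
Proof.
apply/measurable_fun_tnthP => j; rewrite /comp.
under eq_fun do rewrite tnth_mktuple.
case: (j == c); last exact: measurable_tnth.
by apply: measurableT_comp => //; exact: measurable_tnth.
Qed.

Lemma tcons_tnth0 d (p : measurableTypeR R * d.-tuple R) :
  tnth (tcons p) ord0 = p.1.
Proof. exact: tnth0. Qed.

Lemma tcons_tnthS d (p : measurableTypeR R * d.-tuple R) i :
  tnth (tcons p) (lift ord0 i) = tnth p.2 i.
Proof. exact: (tnthS p.1 p.2 i). Qed.

(** By induction on the dimension: on the product of the first coordinate and
the others, the sign change acts on one factor and fixes the other. *)
Lemma leb_mirror d (c : 'I_d) (A : set (d.-tuple R)) : measurable A ->
  leb d (mirror c @^-1` A) = leb d A.
Proof.
elim: d c A => [[]//|d IHd] c A mA.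
pose f (x : measurableTypeR R) : measurableTypeR R :=
  if c == ord0 then - x else x.
pose g (y : d.-tuple R) := if unlift ord0 c is Some c' then mirror c' y else y.
have cons_fg p : mirror c (tcons p) = tcons (f p.1, g p.2).
  apply: eq_from_tnth => j; rewrite tnth_mktuple /f /g.
  case: (unliftP ord0 j) => [j' ->|->];
      rewrite ?tcons_tnthS ?tcons_tnth0 /=; last first.
    by rewrite eq_sym.
  case: unliftP => [c' ->|->].
    by rewrite tnth_mktuple (inj_eq lift_inj).
  by rewrite eq_sym (negbTE (neq_lift _ _)).
have mf : measurable_fun setT f.
  rewrite /f; case: (c == ord0); last exact: measurable_id.
  exact: (@oppr_measurable R setT).
have mA' : measurable (@tcons R d @^-1` A).
  by rewrite -[X in measurable X]setTI; exact: measurable_tcons.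
have fP B : measurable B ->
    @lebesgue_measure R (f @^-1` B) = lebesgue_measure B.
  by rewrite /f; case: (c == ord0) => // mB; exact: lebesgue_measureN.
have gP B : measurable B -> leb d (g @^-1` B) = leb d B.
  by rewrite /g; case: unlift => [c'|] //; exact: IHd.
rewrite /= /leb_succ /pushforward.
rewrite -[RHS](product_preserving (m1 := @lebesgue_measure R) mf fP gP mA').
by congr (product_measure1 _ _ _); apply/funext => p /=; rewrite cons_fg.
Qed.

Lemma enorm_mirror d (c : 'I_d) x : enorm (mirror c x) = enorm x.
Proof.
rewrite /enorm; congr Num.sqrt; apply: eq_bigr => j _.
by rewrite tnth_mktuple; case: ifP => // _; rewrite sqrrN.
Qed.

Lemma direction_mirror d (c : 'I_d) x :
  direction (mirror c x) = mirror c (direction x).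
Proof.
apply: eq_from_tnth => j; rewrite !tnth_mktuple enorm_mirror.
by case: ifP => // _; rewrite mulNr.
Qed.

Lemma monom_mirror d (c : 'I_d) a x :
  monom a (mirror c x) = (-1) ^+ a c * monom a x.
Proof.
rewrite /monom (bigD1 c)//= [in RHS](bigD1 c)//= tnth_mktuple eqxx.
rewrite [X in X * _]exprNn -mulrA; congr (_ * (_ * _)).
by apply: eq_bigr => j /negbTE jc; rewrite tnth_mktuple jc.
Qed.

Lemma measurable_monom d (a : 'I_d -> nat) :
  measurable_fun [set: d.-tuple R] (monom a).
Proof.
apply: measurable_prod => j _; apply: measurable_funX; exact: measurable_tnth.
Qed.

(** The sign change turns the integrand into its opposite. *)
Lemma integral_odd_monom d (mu : {measure set (d.-tuple R) -> \bar R})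
    (D : set (d.-tuple R)) (c : 'I_d) a :
    (forall A, measurable A -> mu (mirror c @^-1` A) = mu A) ->
    measurable D -> mirror c @^-1` D = D -> odd (a c) ->
    mu.-integrable D (EFin \o monom a) ->
  (\int[mu]_(x in D) (monom a x)%:E = 0)%E.
Proof.
move=> mu_mirror mD DE ac intf.
have ff : (EFin \o monom a) \o mirror c = (fun x => (-1)%:E * (monom a x)%:E)%E.
  apply/funext => x /=; rewrite monom_mirror -signr_odd ac expr1.
  by rewrite -EFinM.
have : (\int[mu]_(x in D) (monom a x)%:E =
        (-1)%:E * \int[mu]_(x in D) (monom a x)%:E)%E.
  rewrite -integralZl// -ff -[in RHS]DE.
  apply/esym/(integral_preserving (measurable_mirror c) mu_mirror) => //.
  - by apply/measurable_EFinP; exact: measurable_monom.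
  - rewrite DE ff; exact: integrableZl.
have /fineK <- := integrable_fin_num mD intf.
rewrite -EFinM => -[] /eqP; rewrite mulN1r -subr_eq0 opprK -mulr2n.
by rewrite mulrn_eq0/= => /eqP ->.
Qed.

Lemma sphere_prob_mirror d (c : 'I_d) (A : set (d.-tuple R)) :
  measurable A -> sphere_prob (mirror c @^-1` A) = sphere_prob A.
Proof.
move=> mA; rewrite /sphere_prob /surface_measure; congr (_ * (_ * _))%E.
rewrite -[RHS](leb_mirror c); last exact: measurable_cone.
congr (leb d _); apply/funext => x/=.
by rewrite /cone/= enorm_mirror direction_mirror.
Qed.

Lemma gauss_measure_mirror d (c : 'I_d) (A : set (d.-tuple R)) :
  measurable A -> gauss_measure (mirror c @^-1` A) = gauss_measure A.
Proof.
move=> mA; rewrite /gauss_measure.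
have mg : measurable_fun A (EFin \o @gauss_density R d).
  by apply/measurable_EFinP/measurable_funTS; exact: measurable_gauss_density.
rewrite -(ge0_integral_preserving (mu := leb d) (measurable_mirror c)
  (leb_mirror c) mA mg) => [|x _]; last by rewrite lee_fin expR_ge0.
congr (integral _ _ _); apply/funext => x /=.
by rewrite /gauss_density enorm_mirror.
Qed.

End reflection.

(** * Integrability of the monomials *)

Section gaussian_moments.
Context {R : realType}.

(** From [|u| ^ a <= 1 + u ^ (2 a)] and [u ^ (2 a) <= a! * exp (u ^ 2)]; as
[2 <= pi], the factor [exp (u ^ 2)] is absorbed by the Gaussian density and one
factor [exp (- u ^ 2)] is left. *)
Lemma expr_le_gauss (u : R) (a : nat) :
  `|u| ^+ a * expR (- (pi * u ^+ 2)) <= (1 + a`!%:R) * gauss_fun u.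
Proof.
have ua : `|u| ^+ a <= (1 + a`!%:R) * expR (u ^+ 2).
  have e1 : 1 <= expR (u ^+ 2) by rewrite -expR0 ler_expR sqr_ge0.
  apply: (@le_trans _ _ (1 + (u ^+ 2) ^+ a)).
    rewrite -[u ^+ 2]real_normK ?num_real// exprAC; set v := _ ^+ a; nra.
  rewrite mulrDl mul1r lerD//; case: a => [|a]; first by rewrite fact0 mul1r.
  have := expR_ge1Dxn a (sqr_ge0 u).
  rewrite addrC -lerBrDr => /le_trans/(_ (_ : _ <= expR (u ^+ 2))).
  rewrite ler_pdivrMr ?ltr0n ?fact_gt0// mulrC; apply.
  by rewrite lerBlDr lerDl.
rewrite /gauss_fun (le_trans (ler_wpM2r (expR_ge0 _) ua))// -mulrA.
rewrite ler_wpM2l ?addr_ge0// -expRD ler_expR.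
have := pi_ge2 R; have := sqr_ge0 u; nra.
Qed.

Lemma gauss_density_prod d (x : d.-tuple R) :
  gauss_density x = \prod_(i < d) expR (- (pi * tnth x i ^+ 2)).
Proof. by rewrite /gauss_density enorm_sqr mulr_sumr -sumrN expR_sum. Qed.

Local Open Scope ereal_scope.

Lemma measurable_prod_gauss d :
  measurable_fun [set: d.-tuple R]
    (fun x => (\prod_(i < d) gauss_fun (tnth x i))%R).
Proof.
apply: measurable_prod => i _; apply: measurableT_comp.
  exact: measurable_gauss_fun.
exact: measurable_tnth.
Qed.

Lemma prod_gauss_ge0 d (x : d.-tuple R) :
  (0 <= \prod_(i < d) gauss_fun (tnth x i))%R.
Proof. by apply: prodr_ge0 => i _; exact: gauss_fun_ge0. Qed.

(** By Tonelli's theorem the integral is a power of the one-dimensional one. *)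
Lemma integral_prod_gauss_lty d :
  \int[@leb R d]_x (\prod_(i < d) gauss_fun (tnth x i))%:E < +oo.
Proof.
elim: d => [|d IHd].
  rewrite (eq_integral (cst 1)) => [|x _]; last by rewrite big_ord0.
  by rewrite integral_cst//= mul1e diracT ltry.
pose tc_mixin := isMeasurableFun.Build _ _ _ _ _ (@measurable_tcons R d).
pose tc : {mfun _ >-> _} := HB.pack (@tcons R d) tc_mixin.
pose G n (x : n.-tuple R) := (\prod_(i < n) gauss_fun (tnth x i))%:E.
have mG n : measurable_fun setT (@G n).
  by apply/measurable_EFinP; exact: measurable_prod_gauss.
have G0 n x : 0 <= @G n x by rewrite lee_fin prod_gauss_ge0.
have -> : \int[leb d.+1]_x G _ x =
    \int[pushforward (@lebesgue_measure R \x leb d) tc]_x G _ x.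
  exact: eq_measure_integral.
rewrite ge0_integral_pushforward//; last exact: mG.
rewrite preimage_setT fubini_tonelli1; last 2 first.
- exact: (measurableT_comp (mG d.+1) (@measurable_tcons R d)).
- by move=> x; exact: G0.
have -> : fubini_F (leb d) (G d.+1 \o tc) =
    (fun x => (\int[leb d]_y G d y) * (gauss_fun x)%:E).
  apply/funext => x.
  have gx0 : 0 <= (gauss_fun x)%:E by rewrite lee_fin gauss_fun_ge0.
  rewrite /fubini_F muleC.
  rewrite -(ge0_integralZl (leb d) measurableT (mG d) (fun y _ => G0 d y) gx0).
  congr (integral _ _ _); apply/funext => y; rewrite /G/= big_ord_recl -EFinM.
  rewrite tcons_tnth0; congr (_ * _)%:E; apply: eq_bigr => i _.
  by congr gauss_fun; exact: (tcons_tnthS (x, y) i).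
have K0 : 0 <= \int[leb d]_y G d y.
  exact: (integral_ge0 (leb d) (fun y _ => G0 d y)).
have mg : measurable_fun [set: measurableTypeR R] (fun x => (gauss_fun x)%:E).
  by apply/measurable_EFinP; exact: measurable_gauss_fun.
have g0 (x : measurableTypeR R) : setT x -> 0 <= (gauss_fun x)%:E.
  by move=> _; rewrite lee_fin gauss_fun_ge0.
rewrite (ge0_integralZl (@lebesgue_measure R) measurableT mg g0 K0).
apply: lte_mul_pinfty; [exact: K0|by rewrite ge0_fin_numE|].
by rewrite integralT_gauss ltry.
Qed.

Lemma integrable_monom_gauss d (a : 'I_d -> nat) :
  (@gauss_measure R d).-integrable setT (EFin \o monom a).
Proof.
pose C : R := (\prod_(i < d) (1 + (a i)`!%:R))%R.
have C0 : (0 <= C)%R by apply: prodr_ge0 => i _; rewrite addr_ge0.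
have gd0 (x : d.-tuple R) : (0 <= gauss_density x)%R by exact: expR_ge0.
apply: (integrable_density (mu := leb d) (nu := @gauss_measure R d)
  (@measurable_gauss_density R d) gd0 (fun A _ => erefl)
  (@measurable_monom R d a) (@measurable_prod_gauss d) (@prod_gauss_ge0 d) C0
  _ (integral_prod_gauss_lty d)).
move=> x; rewrite gauss_density_prod /monom normr_prod -!big_split/=.
apply: ler_prod => i _.
by rewrite mulr_ge0 ?expR_ge0//= normrX expr_le_gauss.
Qed.

End gaussian_moments.

Section sphere_moments.
Context {R : realType} {d : nat}.

Lemma measurable_sphere : measurable (@sphere R d).
Proof.
rewrite (_ : sphere = setT `&` @enorm R d @^-1` [set 1]); last first.
  by rewrite setTI.
exact: measurable_enorm.
Qed.

(** By the convention [0^-1 = 0], an infinite total surface would be rescaled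
by 0; so finiteness holds without computing the surface of the sphere. *)
Lemma sphere_prob_lty : (sphere_prob (@sphere R d) < +oo)%E.
Proof.
rewrite /sphere_prob.
have : (0 <= surface_measure (@sphere R d))%E by exact: measure_ge0.
case: (surface_measure _) => [r| |]// _; first by rewrite -EFinM ltry.
by rewrite /= invr0 mul0e.
Qed.

Lemma integrable_monom_sphere (a : 'I_d -> nat) :
  (@sphere_prob R d).-integrable sphere (EFin \o monom a).
Proof.
apply: measurable_bounded_integrable.
- exact: measurable_sphere.
- exact: sphere_prob_lty.
- by apply: measurable_funTS; exact: measurable_monom.
exists 1; split => // r r1 x x1 /=.
rewrite (le_trans _ (ltW r1))// /monom normr_prod.
apply: prodr_ile1 => i _; rewrite normr_ge0 normrX exprn_ile1//.
rewrite -(@ler_pXn2r _ 2) ?nnegrE// expr1n real_normK ?num_real//.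
rewrite -[leRHS](expr1n _ 2) -x1 enorm_sqr (bigD1 i)//= lerDl sumr_ge0// => j _.
exact: sqr_ge0.
Qed.

Lemma mirror_sphere (c : 'I_d) : mirror c @^-1` (@sphere R d) = sphere.
Proof. by apply/seteqP; split => x; rewrite /sphere/= enorm_mirror. Qed.

End sphere_moments.

(** * From moments to designs *)

Section moments.
Context {R : realType} {d : nat}.
Variables (mu : {measure set (d.-tuple R) -> \bar R}) (D : set (d.-tuple R)).
Hypothesis mD : measurable D.
Hypothesis int_monom : forall a, mu.-integrable D (EFin \o monom a).

Definition moment (a : 'I_d -> nat) : R :=
  fine (\int[mu]_(x in D) (monom a x)%:E)%E.

Lemma momentE a : ((moment a)%:E = \int[mu]_(x in D) (monom a x)%:E)%E.
Proof. by rewrite /moment fineK// (integrable_fin_num mD (int_monom a)). Qed.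

Lemma moment_odd :
    (forall c A, measurable A -> mu (mirror c @^-1` A) = mu A) ->
    (forall c, mirror c @^-1` D = D) ->
  forall a, (exists c, odd (a c)) -> moment a = 0.
Proof.
move=> mu_mirror DE a [c ac].
by rewrite /moment (integral_odd_monom (mu_mirror c) mD (DE c) ac).
Qed.

(** By linearity it is enough to match the moments of the monomials. *)
Lemma quad_meval (F : seq (R * d.-tuple R)) t :
    (forall a, (\sum_j a j <= t)%N -> quad F (monom a) = moment a) ->
  forall f : mpoly d R, (mpoly.msize f <= t.+1)%N ->
  ((quad F (fun x => meval (tnth x) f))%:E =
   \int[mu]_(x in D) (meval (tnth x) f)%:E)%E.
Proof.
move=> FM f ft.
have fE x : meval (tnth x) f = \sum_(m <- msupp f) mcoeff m f * monom m x.
  exact: mevalE.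
under [in RHS]eq_integral do rewrite fE -sumEFin.
under [in RHS]eq_integral do under eq_bigr do rewrite EFinM.
rewrite integral_sum//; last by move=> m; exact: integrableZl (int_monom m).
rewrite (eq_quad _ fE) quad_sum -sumEFin big_seq [RHS]big_seq.
apply: eq_bigr => m mf; rewrite quadZ FM.
  by rewrite EFinM momentE integralZl//; exact: int_monom.
by rewrite -mdegE -ltnS (leq_trans _ ft)// msize_mdeg_lt.
Qed.

End moments.

Lemma sphere_moment_bump2 {R : realType} {d : nat} (a : 'I_d -> nat) :
  moment (@sphere_prob R d) sphere a =
  \sum_c moment (@sphere_prob R d) sphere (bump2 a c).
Proof.
apply: EFin_inj; rewrite -sumEFin momentE.
- under [in RHS]eq_bigr => c _.
    rewrite momentE; last 2 first.
    - exact: measurable_sphere.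
    - exact: integrable_monom_sphere.
    over.
  rewrite -integral_sum//.
  - apply: eq_integral => x; rewrite inE => x1.
    by rewrite -(sum_monom_bump2 a x1) sumEFin.
  - exact: measurable_sphere.
  - by move=> c; exact: integrable_monom_sphere.
- exact: measurable_sphere.
- exact: integrable_monom_sphere.
Qed.

Theorem theorem4 (R : realType) (t : nat) (ht : (0 < t)%N) :
  exists C : R, forall d : nat, (1 <= d)%N ->
    (exists (X : {fset d.-tuple R}) (w : X -> R),
       signed_spherical_design t w /\ (#|` X|)%:R <= C * d%:R ^+ (t %/ 2)) /\
    (exists (X : {fset d.-tuple R}) (w : X -> R),
       signed_gaussian_design t w /\ (#|` X|)%:R <= C * d%:R ^+ (t %/ 2)).
Proof.
(* The list lengths are at most [2 * 3 ^ k * d ^ k] on the sphere and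
   [k.+1 * 3 ^ k * d ^ k] in the Gaussian case. *)
set k := (t %/ 2)%N; exists (k.+2 * 3 ^ k)%:R => d d0.
have tk : (t <= k.*2.+1)%N.
  by rewrite {1}(divn_eq t 2) -/k muln2 -[leqRHS]addn1 leq_add2l -ltnS ltn_pmod.
have cardP (T : choiceType) (X : {fset T}) n :
    (#|` X| <= n)%N -> (n <= k.+2 * 3 ^ k * d ^ k)%N ->
    (#|` X|)%:R <= (k.+2 * 3 ^ k)%:R * d%:R ^+ k :> R.
  by move=> Xn nk; rewrite -natrX -natrM ler_nat (leq_trans Xn).
split.
- pose M := moment (@sphere_prob R d) sphere.
  pose F := sphere_quad (Ordinal d0) M k.
  have FM a : (\sum_j a j <= t)%N -> quad F (monom a) = M a.
    move=> at_; apply: sphere_quad_exact; last exact: leq_trans tk.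
      exact: (moment_odd measurable_sphere integrable_monom_sphere
        (@sphere_prob_mirror R d) mirror_sphere).
    exact: sphere_moment_bump2.
  have [X [w [XF Xsub Xw]]] := quad_fset F; exists X, w; split; last first.
    apply: cardP XF _; rewrite size_sphere_quad mulnA.
    by rewrite leq_mul2r leq_mul2r !ltnS leq0n !orbT.
  split=> [x /Xsub[p pF ->]|f ft]; first exact: sphere_sphere_quad pF.
  rewrite (Xw (fun x => meval (tnth x) f)).
  exact: (quad_meval measurable_sphere integrable_monom_sphere FM).
- pose M := moment (@gauss_measure R d) setT.
  pose F := graded_quad M k.
  have FM a : (\sum_j a j <= t)%N -> quad F (monom a) = M a.
    move=> at_; apply: graded_quad_exact; last exact: leq_trans tk.
    exact: (moment_odd measurableT (@integrable_monom_gauss R d)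
      (@gauss_measure_mirror R d)).
  have [X [w [XF _ Xw]]] := quad_fset F; exists X, w; split; last first.
    apply: cardP XF _; rewrite (leq_trans (size_graded_quad _ _ d0))//.
    by rewrite leq_mul2r leq_mul2r leqnSn !orbT.
  move=> f ft; rewrite (Xw (fun x => meval (tnth x) f)).
  exact: (quad_meval measurableT (@integrable_monom_gauss R d) FM ft).
Qed.
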